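(* Let $X_1,X_2$ be locally convex topological vector (LCTV) spaces, let $\Omega_1\subset X_1$ and $\Omega_2\subset X_2$ be nonempty compact convex sets, and let $u_1,u_2\colon X_1\times X_2\to\mathbb{R}$ be continuous payoff functions in the two-person game $\{\Omega_i,u_i\}$, $i=1,2$. Suppose that: (a) $u_1(\cdot,q)$ is concave for every fixed $q\in\Omega_2$; (b) $u_2(p,\cdot)$ is concave for every fixed $p\in\Omega_1$. Then this game admits a Nash equilibrium point.
   Context: All vector spaces are over $\mathbb{R}$, and LCTV spaces are assumed Hausdorff. In (a), $u_1(\cdot,q)$ is regarded as a function on $X_1$; in (b), $u_2(p,\cdot)$ is regarded as a function on $X_2$. A Nash equilibrium point of the game $\{\Omega_i,u_i\}$, $i=1,2$, is a pair $(\bar p,\bar q)\in\Omega_1\times\Omega_2$ such that $u_1(p,\bar q)\le u_1(\bar p,\bar q)$ for all $p\in\Omega_1$ and $u_2(\bar p,q)\le u_2(\bar p,\bar q)$ for all $q\in\Omega_2$. *)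

(* Defs.v *)
From HB Require Import structures.
From mathcomp Require Import all_boot all_order all_algebra.
From mathcomp Require Import all_classical all_reals all_analysis.

Set Implicit Arguments.
Unset Strict Implicit.
Unset Printing Implicit Defensive.

Import Order.TTheory GRing.Theory Num.Theory.
Import numFieldNormedType.Exports.

Local Open Scope classical_set_scope.
Local Open Scope ring_scope.
Local Open Scope convex_scope.

(* Mirrors [convex_function] of mathcomp-analysis, with the inequality
   reversed; [x <| t |> y] is [t *: x + (1 - t) *: y] for t in [0, 1]. *)
Definition concave_function (R : numFieldType) (E : lmodType R)
    (E' := convex_lmodType E) (D : set E') (f : E' -> R^o) :=
  forall t : {i01 R},
    {in D &, forall x y : E', (f x <| t |> f y <= f (x <| t |> y))%R}.

Definition nash_equilibrium (R : realType) (X1 X2 : Type)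
    (Omega1 : set X1) (Omega2 : set X2) (u1 u2 : X1 * X2 -> R)
    (pq : X1 * X2) : Prop :=
  [/\ (Omega1 `*` Omega2) pq,
      forall p, Omega1 p -> u1 (p, pq.2) <= u1 pq &
      forall q, Omega2 q -> u2 (pq.1, q) <= u2 pq].

(* Main.v *)
Require Import Defs.
From HB Require Import structures.
From mathcomp Require Import all_boot all_order all_algebra.
From mathcomp Require Import all_classical all_reals all_analysis.
From mathcomp Require Import zify ring lra.

Set Implicit Arguments.
Unset Strict Implicit.
Unset Printing Implicit Defensive.

Import Order.TTheory GRing.Theory Num.Theory.
Import numFieldNormedType.Exports.

Local Open Scope classical_set_scope.
Local Open Scope ring_scope.

(** Put f(x, y) = u1(x1, y2) - u1(y) + u2(y1, x2) - u2(y) on the compact convex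
    set K = Omega1 * Omega2. A point y of K with f(x, y) <= 0 for all x in K is
    exactly a Nash equilibrium: test it against x = (p, y2) and x = (y1, q).
    Since f is continuous in y, concave in x and null on the diagonal, such a
    point is given by Ky Fan's inequality ([ky_fan_inequality]).

    By compactness of K it is enough to treat finitely many points x_i, and to
    find p in K with g_i(p) = f(x_i, p) <= 0 for every i
    ([exists_all_le0_finite]). Concavity and f(y, y) <= 0 provide the relation
    sum_i w_i g_i(sum_j w_j x_j) <= 0 for all barycentric weights w. Label each w
    by an index i that maximises g_i at the barycenter of w. The combinatorial
    result [simplex_labels] produces weights w such that every index i with
    w_i > 0 labels some weights as close to w as desired. As the closeness
    improves, the barycenters cluster at some p in K, near which every index
    carrying weight almost maximises g_i, so the relation says that
    max_i g_i(p) <= 0.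

    Such labelled weights come from Scarf's combinatorial form of Sperner's
    lemma, in which no triangulation is needed: the role of the simplices is
    played by the subsets of a finite set that are primitive for a family of
    total orders. Primitive sets meet along facets like the top simplices of a
    triangulation do ([card_inner_completions], [card_outer_completions]), and
    Sperner's parity count then yields a primitive set bearing all the labels
    ([exists_rainbow]). For the points of the simplex with coordinates in
    (1/m) Z, ordered by each of their coordinates, being primitive forces a set
    to be of small diameter ([grid_labels]). *)

Section Combinatorics.
(* Lemma names shared by finite sets and classical sets mean finite sets here. *)
Import ssrnat fintype boot.finset bigop.
Local Open Scope set_scope.
Local Open Scope nat_scope.

(** * Primitive sets and their completions *)

Section Primitive.
Variables (N V : finType) (r : N -> V -> nat).
Hypothesis r_inj : forall i, injective (r i).

(** Here [r i] ranks the elements of [V] for the [i]-th total order. No element of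
    [V] lies above the minimum of [Z] in all the orders at once. *)
Definition primitive (Z : {set V}) :=
  [forall v, exists i, forall z in Z, r i v <= r i z].

Lemma primitiveP (Z : {set V}) :
  reflect (forall v, exists i, forall z, z \in Z -> r i v <= r i z) (primitive Z).
Proof.
apply: (iffP forallP) => P v; have := P v.
  by move=> /existsP[i /forall_inP H]; exists i.
by move=> [i H]; apply/existsP; exists i; apply/forall_inP.
Qed.

Lemma primitiveS (W Z : {set V}) : W \subset Z -> primitive Z -> primitive W.
Proof.
move=> WZ /primitiveP P; apply/primitiveP => v; have [i H] := P v.
by exists i => z /(subsetP WZ); apply: H.
Qed.

Lemma imset_setC1_inj (m : N -> V) (W : {set V}) i :
  #|W|.+1 = #|N| -> m @: [set~ i] = W -> {in [set~ i] &, injective m}.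
Proof.
move=> cW mW; apply/imset_injP; rewrite mW cardsC1 -cW //.
Qed.

(** An inner facet belongs to exactly two simplices. The map sending [i] to the
    [r i]-minimum of [W] is onto [W] because [W] is primitive, and [#|W|] is one
    less than the number of orders, so exactly two orders [i1], [i2] share their
    minimum. A completing element must become the minimum of [i1] or of [i2]
    without disturbing any other minimum; each case has a unique solution, the
    [r i]-greatest element of the set [M i] of candidates. The slack elements
    [e i] ensure that there is a candidate, as soon as [W] has an element that is
    not a slack. *)
Lemma card_inner_completions (e : N -> V) (W : {set V}) (x : V) :
  (forall i j y, j != i -> y \notin codom e -> r i y < r i (e j)) ->
  #|W|.+1 = #|N| -> x \in W -> x \notin codom e -> primitive W ->
  #|[set v | (v \notin W) && primitive (v |: W)]| = 2.
Proof.
move=> e_top cW xW xe /primitiveP pW.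
pose m i := [arg min_(z < x in W) r i z].
have mP i : m i \in W /\ forall z, z \in W -> r i (m i) <= r i z.
  by rewrite /m; case: arg_minnP.
have mmin i z : z \in W -> (forall z', z' \in W -> r i z <= r i z') -> m i = z.
  move=> zW H; apply: (@r_inj i); apply/eqP; rewrite eqn_leq.
  by rewrite (mP i).2// H// (mP i).1.
have mW : m @: [set: N] = W.
  apply/setP => w; apply/imsetP/idP => [[i _ ->]|wW]; first exact: (mP i).1.
  by have [i H] := pW w; exists i => //; rewrite (mmin i w).
have [i1 [i2 [i12 m12]]] : exists i1 i2, i1 != i2 /\ m i1 = m i2.
  have /injectivePn[i1 [i2 *]] : ~~ injectiveb m; last by exists i1, i2.
  apply/negP => /injectiveP mi.
  by have := card_imset [set: N] mi; rewrite mW cardsT -cW => /eqP; lia.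
have mWi i : i \in [:: i1; i2] -> m @: [set~ i] = W.
  move=> ii; apply/setP => w; apply/imsetP/idP => [[j _ ->]|]; first exact: (mP j).1.
  rewrite -mW => /imsetP[j _ ->].
  have [ji|] := eqVneq j i; last by move=> ?; exists j => //; rewrite !inE.
  move: ii; rewrite !inE => /orP[]/eqP ii; subst i j.
    by exists i2 => //; rewrite !inE eq_sym.
  by exists i1 => //; rewrite !inE.
(* Adding an element of [M i] to [W] can only change the minimum for [i]. *)
pose M i := [set v | [forall j in [set~ i], r j (m j) < r j v]].
have MP i v : reflect (forall j, j != i -> r j (m j) < r j v) (v \in M i).
  rewrite inE; apply: (iffP forall_inP) => H j; first by move=> ?; apply: H; rewrite !inE.
  by rewrite !inE => /H.
have eM i : e i \in M i.
  apply/MP => j ji; apply: (leq_ltn_trans ((mP j).2 _ xW)).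
  by apply: e_top => //; rewrite eq_sym.
pose X i := [arg max_(v > e i in M i) r i v].
have XP i : X i \in M i /\ forall v, v \in M i -> r i v <= r i (X i).
  by rewrite /X; case: arg_maxnP.
have MW i v : i \in [:: i1; i2] -> v \in M i -> v \notin W.
  move=> /mWi <- /MP vM; apply/imsetP => -[j]; rewrite !inE => /vM + vm.
  by rewrite vm ltnn.
have MW' i v : i \in [:: i1; i2] -> v \in M i -> r i v < r i (m i).
  move=> ii vM; rewrite ltn_neqAle; apply/andP; split.
    apply: contraNneq (MW _ _ ii vM) => /r_inj ->; exact: (mP i).1.
  have [k vk] := pW v; have [<-|ki] := eqVneq k i; first exact: vk (mP k).1.
  by move/MP: vM => /(_ _ ki); rewrite ltnNge vk//; exact: (mP k).1.
suff -> : [set v | (v \notin W) && primitive (v |: W)] = [set X i1; X i2].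
  rewrite cards2; suff -> : X i1 != X i2 by [].
  apply/eqP => X12; have := MW' i2 _ _ (XP i2).1.
  rewrite !inE eqxx orbT => /(_ isT); rewrite -X12 ltnNge => /negP; apply.
  by apply: ltnW; have /MP := (XP i1).1; apply; rewrite eq_sym.
apply/setP => v; rewrite !inE; apply/andP/idP; last first.
  have sym i : i \in [:: i1; i2] -> v = X i ->  v \notin W /\ primitive (v |: W).
    move=> ii vX; have vM : v \in M i by rewrite vX; case: (XP i).
    split; first exact: MW ii vM.
    apply/primitiveP => u; have [uM|] := boolP (u \in M i).
      have uv : r i u <= r i v by rewrite vX; exact: (XP i).2.
      exists i => z; rewrite !inE => /orP[/eqP->//|zW].
      by have := MW' _ _ ii vM; have := (mP i).2 _ zW; lia.
    rewrite inE negb_forall_in => /exists_inP[j ji]; rewrite -leqNgt => uj.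
    exists j => z; rewrite !inE => /orP[/eqP->|/(mP j).2]; last by lia.
    by move/MP: vM => /(_ j); rewrite !inE in ji; move=> /(_ ji); lia.
  by case/orP => /eqP; apply: sym; rewrite !inE eqxx ?orbT.
move=> [vW /primitiveP pv].
(* [v] is the new minimum for the order [i], so the other orders must account
   for all of [W]; this leaves only [i1] and [i2]. *)
have [i iv] := pv v.
have mWi' : m @: [set~ i] = W.
  apply/setP => w; apply/imsetP/idP => [[j _ ->]|wW]; first exact: (mP j).1.
  have [j jw] := pv w; exists j; last first.
    by rewrite (mmin j w)// => z zW; apply: jw; rewrite !inE zW orbT.
  rewrite !inE; apply: contraNneq vW => ji; subst j.
  suff -> : v = w by [].
  apply: (@r_inj i); apply/eqP; rewrite eqn_leq iv ?jw// !inE ?eqxx ?wW ?orbT//.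
have mi := imset_setC1_inj cW mWi'.
have ii : i \in [:: i1; i2].
  rewrite !inE -[X in is_true X]negbK negb_or; apply/negP => /andP[ii1 ii2].
  by move/negP: i12; apply; apply/eqP; apply: mi; rewrite // !inE eq_sym.
have vM : v \in M i.
  apply/MP => j ji; rewrite ltn_neqAle; apply/andP; split.
    by apply: contraNneq vW => /r_inj <-; exact: (mP j).1.
  have [k kj] := pv (m j).
  have ki : k != i.
    apply: contraNneq vW => ki; subst k.
    suff -> : v = m j by exact: (mP j).1.
    apply: (@r_inj i); apply/eqP; rewrite eqn_leq kj ?iv// !inE ?eqxx//.
    by rewrite (mP j).1 orbT.
  suff jk : j = k by subst k; apply: kj; rewrite !inE eqxx.
  apply: mi; rewrite ?inE//; apply/esym/mmin; first exact: (mP j).1.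
  by move=> z zW; apply: kj; rewrite !inE zW orbT.
suff -> : v = X i by move: ii; rewrite !inE => /orP[]/eqP->; rewrite eqxx ?orbT.
apply: (@r_inj i); apply/eqP; rewrite eqn_leq (XP i).2//=.
have [k uk] := pv (X i).
have [ki|ki] := eqVneq k i; first by subst k; apply: uk; rewrite !inE eqxx.
have /MP /(_ _ ki) := (XP i).1; rewrite ltnNge uk// !inE (mP k).1 orbT//.
Qed.
End Primitive.

(** * Parity count *)

(** If [c] is a bijection from [Z], only the point labelled [i0] can be removed.
    Otherwise, if some removal leaves each label other than [i0] once, then one of
    these labels occurs twice in [Z], and its two occurrences are the possible
    removals. *)
Lemma odd_facets (N V : finType) (c : V -> N) (i0 : N) (Z : {set V}) :
  #|Z| = #|N| ->
  odd #|[set z in Z | c @: (Z :\ z) == [set~ i0]]| = (c @: Z == [set: N]).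
Proof.
move=> cZ; set F := [set z in Z | _].
have [cT|cnT] := eqVneq (c @: Z) [set: N].
  have c_inj : {in Z &, injective c} by apply/imset_injP; rewrite cT cardsT cZ.
  have [z0 z0Z z0i] : exists2 z, z \in Z & i0 = c z.
    by apply/imsetP; rewrite cT inE.
  suff -> : F = [set z0] by rewrite cards1.
  apply/setP => z; rewrite !inE; apply/andP/eqP => [[zZ /eqP cz]|->].
    apply/eqP; apply/negPn/negP => zz0.
    have : i0 \in c @: (Z :\ z) by apply/imsetP; exists z0; rewrite // !inE eq_sym zz0.
    by rewrite cz !inE eqxx.
  split=> //; apply/eqP/setP => j; rewrite !inE; apply/imsetP/idP.
    move=> [w]; rewrite !inE => /andP[wz0 wZ] ->.
    by apply: contraNneq wz0; rewrite z0i => /c_inj ->.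
  move=> ji; have /imsetP[w wZ jw] : j \in c @: Z by rewrite cT inE.
  exists w; rewrite // !inE wZ andbT.
  by apply: contraNneq ji; rewrite jw z0i => ->.
have [->|[z0]] := set_0Vmem F; first by rewrite cards0.
rewrite inE => /andP[z0Z /eqP cz0].
have cZ0 : #|Z :\ z0|.+1 = #|N| by rewrite -cZ (cardsD1 z0 Z) z0Z.
have c_inj : {in Z :\ z0 &, injective c}.
  by apply/imset_injP; rewrite cz0 cardsC1 -cZ0.
have cz0i : c z0 != i0.
  apply: contra cnT => /eqP cz0i; rewrite -(setD1K z0Z) imsetU1 cz0 cz0i.
  by rewrite setUC; apply/eqP/setP => j; rewrite !inE orNb.
have /imsetP[z1 z1Z cz1] : c z0 \in c @: (Z :\ z0) by rewrite cz0 !inE.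
have z10 : z1 != z0 by move: z1Z; rewrite !inE => /andP[].
suff -> : F = [set z0; z1] by rewrite cards2 eq_sym z10.
apply/setP => z; rewrite !inE; apply/andP/idP => [[zZ /eqP cz]|].
  rewrite -[X in is_true X]negbK negb_or; apply/negP => /andP[zz0 zz1].
  have : c z \in c @: (Z :\ z).
    rewrite cz -cz0 imset_f// !inE zz0//.
  case/imsetP => y; rewrite !inE => /andP[yz yZ] zy.
  have [y0|y0] := eqVneq y z0.
    move: zy; rewrite y0 cz1 => /c_inj; rewrite !inE zz0 zZ.
    by move: z1Z; rewrite !inE => -> /(_ isT isT) /eqP; rewrite (negbTE zz1).
  by move/c_inj: zy; rewrite !inE zz0 zZ y0 yZ => /(_ isT isT) zy; rewrite zy eqxx in yz.
case/orP => /eqP ->; first by rewrite cz0.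
move: z1Z; rewrite !inE => /andP[_ z1Z]; split=> //.
rewrite -cz0; apply/eqP/setP => j; apply/imsetP/imsetP => -[y].
  rewrite !inE => /andP[yz1 yZ] ->.
  have [->|y0] := eqVneq y z0; last by exists y; rewrite // !inE y0.
  by exists z1; rewrite // !inE z10.
rewrite !inE => /andP[y0 yZ] ->.
have [->|y1] := eqVneq y z1; last by exists y; rewrite // !inE y1.
by exists z0; rewrite // !inE eq_sym z10.
Qed.

(** The slack [e i] stands for the face of the simplex where the [i]-th coordinate
    vanishes: it is last for the order [i] and above all non-slack elements for
    the other orders. *)
Section Rainbow.
Variables (N V : finType) (r : N -> V -> nat) (e : N -> V) (c : V -> N).
Hypothesis r_inj : forall i, injective (r i).
Hypothesis e_bot : forall i v, r i (e i) <= r i v.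
Hypothesis e_top : forall i j y, j != i -> y \notin codom e -> r i y < r i (e j).
Hypothesis ce : forall i, c (e i) = i.

(** The outer facet, made of all slacks but [e i0], belongs to a single simplex:
    the completing element has to be the greatest non-slack one for [i0]. *)
Lemma card_outer_completions (x : V) (i0 : N) : x \notin codom e ->
  #|[set v | (v \notin e @: [set~ i0]) && primitive r (v |: e @: [set~ i0])]| = 1.
Proof.
move=> xe; set W := e @: _.
have eW j : (e j \in W) = (j != i0).
  apply/imsetP/idP => [[k]|ji]; last by exists j; rewrite // !inE.
  by rewrite !inE => ki /(congr1 c); rewrite !ce => ->.
have codomW v : v \notin codom e -> v \notin W.
  by apply: contra => /imsetP[k _ ->]; exact: codom_f.
have not_bot i v : v \notin codom e -> r i v <= r i (e i) -> False.
  move=> ve vi; move: ve; suff -> : v = e i by rewrite codom_f.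
  by apply: (@r_inj i); apply/eqP; rewrite eqn_leq vi e_bot.
pose y := [arg max_(v > x | v \notin codom e) r i0 v].
have [ye ymax] : y \notin codom e /\ forall v, v \notin codom e -> r i0 v <= r i0 y.
  by rewrite /y; case: arg_maxnP.
suff -> : [set v | (v \notin W) && primitive r (v |: W)] = [set y] by rewrite cards1.
apply/setP => v; rewrite !inE; apply/andP/eqP => [[vW /primitiveP pv]|->].
  have ve : v \notin codom e.
    apply/negP => /codomP[j jv].
    have ji : j = i0 by move: vW; rewrite jv eW negbK => /eqP.
    have [i xi] := pv x; apply: (not_bot i x xe); apply: xi.
    by rewrite jv ji !inE eW; have [->|] := eqVneq i i0; rewrite ?eqxx ?orbT.
  apply: (@r_inj i0); apply/eqP; rewrite eqn_leq ymax//=.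
  have [i yi] := pv y.
  suff ii : i = i0 by rewrite -ii; apply: yi; rewrite !inE eqxx.
  apply/eqP/negPn/negP => ii; apply: (not_bot i y ye); apply: yi.
  by rewrite !inE eW ii orbT.
split; first exact: codomW.
apply/primitiveP => u; have [/codomP[j ->]|ue] := boolP (u \in codom e).
  by exists j => z _; exact: e_bot.
exists i0 => z; rewrite !inE => /orP[/eqP->|/imsetP[j]]; first exact: ymax.
by rewrite !inE => ji ->; apply/ltnW/e_top.
Qed.

Lemma odd_completions (x : V) (i0 : N) (W : {set V}) : x \notin codom e ->
  #|W|.+1 = #|N| -> c @: W = [set~ i0] ->
  odd #|[set v | (v \notin W) && primitive r (v |: W)]| = (W == e @: [set~ i0]).
Proof.
move=> xe cW cWi; have [->|We] := eqVneq W _.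
  by rewrite (card_outer_completions _ xe).
have [y yW ye] : exists2 y, y \in W & y \notin codom e.
  apply/subsetPn; apply: contra We => /subsetP We.
  rewrite eqEcard card_imset; last by move=> i j /(congr1 c); rewrite !ce.
  rewrite cardsC1 -cW leqnn andbT; apply/subsetP => w wW.
  have /codomP[i wi] := We _ wW; rewrite wi imset_f// -cWi.
  by rewrite -[i]ce -wi imset_f.
have [pW|pW] := boolP (primitive r W).
  by rewrite (card_inner_completions (e := e) r_inj e_top cW yW ye pW).
rewrite (_ : [set v | _] = set0) ?cards0//.
apply/setP => v; rewrite !inE; apply/negP => /andP[_ pv].
by move/negP: pW; apply; apply: primitiveS pv; exact: subsetUr.
Qed.

Lemma odd_sum (I : finType) (P : pred I) (F : I -> nat) :
  odd (\sum_(i | P i) F i) = odd #|[set i | P i & odd (F i)]|.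
Proof.
rewrite -sum1_card (big_mkcond (mem [set i | P i & odd (F i)])) (big_mkcond P) /=.
elim/big_rec2: _ => // i a b _ ab; rewrite !oddD ab inE.
by case: (P i) => //=; case: (odd (F i)).
Qed.

(** Sperner's count: the incidences between the facets labelled by all of [N]
    except [i0] and the primitive sets with [#|N|] elements are odd in number when
    counted by facets, as there is one outer facet; counted by primitive sets,
    they have the parity of the number of primitive sets bearing all labels. *)
Theorem exists_rainbow (x : V) : x \notin codom e ->
  exists2 Z : {set V}, primitive r Z & c @: Z = [set: N].
Proof.
move=> xe; pose i0 := c x.
pose door (W : {set V}) := (#|W|.+1 == #|N|) && (c @: W == [set~ i0]).
pose room (Z : {set V}) := (#|Z| == #|N|) && primitive r Z.
pose ends (W : {set V}) := [set v | (v \notin W) && primitive r (v |: W)].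
pose facets (Z : {set V}) := [set z in Z | c @: (Z :\ z) == [set~ i0]].
have double : \sum_(W | door W) #|ends W| = \sum_(Z | room Z) #|facets Z|.
  transitivity (\sum_(v : V) \sum_(W | door W && (v \in ends W)) 1).
    rewrite (exchange_big_dep door)//=; last by move=> ? ? _ /andP[].
    by apply: eq_bigr => W dW; rewrite -sum1_card; apply: eq_bigl => v; rewrite dW.
  transitivity (\sum_(v : V) \sum_(Z | room Z && (v \in facets Z)) 1); last first.
    rewrite (exchange_big_dep room)//=; last by move=> ? ? _ /andP[].
    by apply: eq_bigr => W dW; rewrite -sum1_card; apply: eq_bigl => v; rewrite dW.
  apply: eq_bigr => v _.
  (* Facets missing [v] correspond to primitive sets containing [v]. *)
  rewrite (reindex_onto (fun Z => Z :\ v) (fun W => v |: W)); last first.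
    by move=> W /andP[_]; rewrite inE => /andP[vW _]; rewrite setU1K.
  apply: eq_bigl => Z; rewrite /door /room !inE eqxx /= -andbA.
  have [vZ|vZ] := boolP (v \in Z); last first.
    rewrite [v |: (Z :\ v) == Z]negbTE ?andbF//.
    by apply: contraNneq vZ => <-; rewrite !inE eqxx.
  by rewrite setD1K// eqxx andbT (cardsD1 v Z) vZ add1n /= andbAC.
have oddL : odd (\sum_(W | door W) #|ends W|).
  rewrite odd_sum (_ : [set W | _ & _] = [set e @: [set~ i0]]) ?cards1//.
  have e_inj : injective e by move=> i j /(congr1 c); rewrite !ce.
  apply/setP => W; rewrite !inE; apply/andP/eqP => [[/andP[/eqP cW /eqP cWi]]|We].
    by rewrite (odd_completions xe cW cWi) => /eqP.
  have cW : #|W|.+1 = #|N|.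
    by rewrite We card_imset// cardsC1 prednK//; apply/card_gt0P; exists i0.
  have cWi : c @: W = [set~ i0].
    by rewrite We -imset_comp (eq_imset (g := id)) ?imset_id// => i; exact: ce.
  by rewrite (odd_completions xe cW cWi) /door cW cWi We !eqxx.
move: oddL; rewrite double odd_sum => oddL.
have /card_gt0P[Z] : 0 < #|[set Z | room Z & odd #|facets Z|]| by case: #|_| oddL.
rewrite inE => /andP[/andP[/eqP cZ pZ]]; rewrite odd_facets// => /eqP cT.
by exists Z.
Qed.
End Rainbow.

(** * Labelled points of a simplex *)

(** Scarf's lemma without slacks: [exists_rainbow] applies to [X + I], where the
    elements of [I] are added to [X] as slacks. The indices whose slack is not
    used form [S], and they must be labels of genuine elements. *)
Lemma scarf_dominating_pair (I X : finType) (r : I -> X -> nat) (c : X -> I) (x0 : X) :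
  (forall i, injective (r i)) ->
  exists (S : {set I}) (Y : {set X}),
    (forall i, i \in S -> exists2 y, y \in Y & c y = i) /\
    (forall x, exists2 i, i \in S & forall y, y \in Y -> r i x <= r i y).
Proof.
move=> r_inj.
pose B i := \max_x r i x.
have rB i x : r i x <= B i by exact: leq_bigmax.
pose s i (v : X + I) := match v with
  | inl x => (r i x).+1
  | inr j => if j == i then 0 else (B i).+2 + enum_rank j end.
pose lab (v : X + I) := match v with inl x => c x | inr j => j end.
have s_inj i : injective (s i).
  move=> [x|j] [y|k] /=.
  - by case=> /r_inj ->.
  - by case: eqP => // _; have := rB i x; lia.
  - by case: eqP => // _; have := rB i y; lia.
  - case: eqP => [->|_]; case: eqP => [->|_] //.
    by move=> /addnI /val_inj /enum_rank_inj ->.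
have nslack x : inl x \notin codom (inr : I -> X + I).
  by apply/negP => /codomP[].
have [| | |Z /primitiveP pZ cZ] :=
    @exists_rainbow I _ s inr lab s_inj _ _ _ (inl x0) (nslack x0).
- by move=> i v; rewrite /= eqxx.
- move=> i j [x|k] ji; last by rewrite codom_f.
  by move=> _ /=; rewrite (negbTE ji); have := rB i x; lia.
- by [].
exists [set i | inr i \notin Z], [set x | inl x \in Z]; split.
  move=> i; rewrite inE => iZ.
  have /imsetP[[y|j] vZ iv] : i \in lab @: Z by rewrite cZ inE.
    by exists y; rewrite ?inE.
  by move: iZ; rewrite iv vZ.
move=> x; have [i xi] := pZ (inl x); exists i.
  by rewrite inE; apply/negP => /xi; rewrite /= eqxx.
by move=> y; rewrite inE => /xi.
Qed.

(** The points of the grid are ordered by their [i]-th coordinate, ties being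
    broken by enumeration. Let [mu i] be the least [i]-th coordinate on [Y]. If
    the sum of [mu] over [S] were at most [m - #|S|], then increasing all of them
    by at least one would give a point of the grid contradicting the domination property.
    Hence the points of [Y] are all close to [mu] on [S] and close to zero outside
    [S], and [t] is [mu] with the small defect added at some [s] in [S]. *)
Lemma grid_labels (I : finType) (m : nat) (c : {ffun I -> 'I_m.+1} -> I) :
  exists2 t : {ffun I -> 'I_m.+1}, \sum_i t i = m &
    forall i, 0 < t i -> exists y : {ffun I -> 'I_m.+1},
      [/\ \sum_j y j = m, c y = i &
          forall j, t j <= y j + #|I| /\ y j <= t j + #|I|].
Proof.
pose X := {p : {ffun I -> 'I_m.+1} | \sum_i p i == m}.
have mkX (p : I -> nat) : \sum_i p i = m -> exists q : X, forall i, val q i = p i :> nat.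
  move=> pm; have pi i : p i < m.+1 by rewrite ltnS -pm (bigD1 i)//= leq_addr.
  pose q := [ffun i => Ordinal (pi i)].
  have qm : \sum_i q i == m.
    by apply/eqP; rewrite -[RHS]pm; apply: eq_bigr => i _; rewrite ffunE.
  by exists (Sub q qm) => i; rewrite SubK ffunE.
pose k0 : I := c [ffun=> ord0].
have [x0 _] : exists q : X, forall i, val q i = (if i == k0 then m else 0) :> nat.
  apply: (mkX (fun i => if i == k0 then m else 0)).
  by rewrite -big_mkcond big_pred1_eq.
(* Lexicographic rank of the pair ([i]-th coordinate, index of [x]). *)
pose r i (x : X) := val x i * #|{: X}| + enum_rank x.
have r_le i x y : r i x <= r i y -> val x i <= val y i.
  have lex K a a' b b' : b' < K -> a * K + b <= a' * K + b' -> a <= a'.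
    by move=> ? ?; rewrite -ltnS -(@ltn_pmul2r K) ?mulSn; lia.
  exact/lex/ltn_ord.
have r_inj i : injective (r i).
  move=> x y xy; have xyi : val x i = val y i :> nat.
    by apply/eqP; rewrite eqn_leq !r_le// xy.
  by move: xy; rewrite /r xyi => /addnI /val_inj /enum_rank_inj.
have [S [Y [lab dom]]] := scarf_dominating_pair (fun x => c (val x)) x0 r_inj.
have [s sS _] := dom x0.
have [y0 y0Y _] := lab _ sS.
pose mu i := val [arg min_(y < y0 in Y) (val y i : nat)] i : nat.
have muP i : (exists2 y, y \in Y & mu i = val y i) /\ forall y, y \in Y -> mu i <= val y i.
  by rewrite /mu; case: arg_minnP => // y yY ymin; split=> //; exists y.
have sumX (q : X) : \sum_i val q i = m by exact/eqP/(valP q).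
have sumSX (q : X) : \sum_(i in S) val q i <= m.
  by rewrite -[leqRHS](sumX q) [leqRHS](bigID (mem S))/= leq_addr.
pose M := \sum_(i in S) mu i.
have Mm : M <= m.
  by apply: leq_trans (sumSX y0); apply: leq_sum => i _; exact: (muP i).2.
have Mbig : m < M + #|S|.
  rewrite ltnNge; apply/negP => le_m.
  have [q qE] : exists q : X, forall i, val q i =
    (if i \in S then (mu i).+1 + (if i == s then m - (M + #|S|) else 0) else 0) :> nat.
    apply: mkX; rewrite -big_mkcond big_split/=.
    rewrite (eq_bigr (fun i => mu i + 1)) => [|i _]; last by rewrite addn1.
    rewrite big_split/= sum1_card -/M -big_mkcondr/= (big_pred1 s) ?subnKC// => i.
    by rewrite /=; have [->|] := eqVneq i s; rewrite ?andbT ?andbF.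
  have [i iS qi] := dom q; have [y yY yi] := (muP i).1.
  have := r_le _ _ _ (qi _ yY); rewrite qE iS -yi; lia.
have cardS : #|S| <= #|I| by exact: max_card.
have [t tE] : exists q : X, forall i, val q i =
  (if i \in S then mu i + (if i == s then m - M else 0) else 0) :> nat.
  apply: mkX; rewrite -big_mkcond big_split/= -/M -big_mkcondr/= (big_pred1 s) ?subnKC// => i.
  by rewrite /=; have [->|] := eqVneq i s; rewrite ?andbT ?andbF.
exists (val t); first exact: sumX.
move=> i ti; have iS : i \in S by move: ti; rewrite tE; case: (i \in S).
have [y yY yi] := lab _ iS; exists (val y); split=> [|//|j]; first exact: sumX.
rewrite tE; have [jS|jS] := boolP (j \in S).
  have yj := (muP j).2 _ yY.
  have : val y j + (M - mu j) <= m.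
    apply: leq_trans (sumSX y); rewrite (bigD1 j)//= leq_add2l /M (bigD1 j)//= addKn.
    by apply: leq_sum => k _; exact: (muP k).2.
  have : mu j <= M by rewrite /M (bigD1 j)//= leq_addr.
  by case: ifP => _; lia.
have : val y j + M <= m.
  rewrite -[leqRHS](sumX y) (bigD1 j)//= leq_add2l /M.
  rewrite big_mkcond [leqRHS]big_mkcond/=; apply: leq_sum => k _.
  case: (boolP (k \in S)) => // kS; rewrite (memPn jS)// (muP k).2//.
by lia.
Qed.

End Combinatorics.

Definition barycentric (R : numDomainType) (I : finType) (w : I -> R) :=
  (forall i, 0 <= w i) /\ \sum_i w i = 1.

(** This form of Sperner's lemma does not restrict labels on the boundary: it is
    the support of [w] that adapts to the labels. *)
Lemma simplex_labels (R : archiRealFieldType) (I : finType)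
    (c : (I -> R) -> I) (d : R) : 0 < d ->
  exists2 w, barycentric w &
    forall i, 0 < w i -> exists w',
      [/\ barycentric w', c w' = i & forall j, `|w' j - w j| <= d].
Proof.
move=> d0; pose m := (Num.bound (#|I|%:R / d)).+1.
have m0 : 0 < m%:R :> R by rewrite ltr0n.
have Imd : #|I|%:R <= m%:R * d.
  rewrite -ler_pdivrMr// (le_trans (ltW (archi_boundP _)))//.
    by rewrite divr_ge0// ltW.
  by rewrite ler_nat.
pose pt (t : {ffun I -> 'I_m.+1}) i : R := (t i)%:R / m%:R.
have ptS (t : {ffun I -> 'I_m.+1}) : (\sum_i t i)%N = m -> barycentric (pt t).
  move=> tm; split=> [i|]; first by rewrite divr_ge0.
  by rewrite -mulr_suml -natr_sum tm divff// gt_eqF.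
have [t tm tP] := grid_labels (fun t : {ffun I -> 'I_m.+1} => c (pt t)).
exists (pt t); first exact: ptS.
move=> i; rewrite pmulr_lgt0 ?invr_gt0// ltr0n => /tP[y [ym ci yt]].
exists (pt y); split=> // [|j]; first exact: ptS.
rewrite -mulrBl normrM [`|_^-1|]ger0_norm ?invr_ge0// ler_pdivrMr// mulrC.
rewrite (le_trans _ Imd)// ler_norml lerBrDl !lerBlDr -!natrD !ler_nat.
by have [-> ?] := yt j; rewrite addnC.
Qed.

(** * Barycenters *)

Lemma convex_set_barycenter (R : numFieldType) (E : lmodType R) (A : set E)
    (I : finType) (w : I -> R) (x : I -> E) :
  convex_set A -> barycentric w -> (forall i, A (x i)) ->
  A (\sum_i w i *: x i).
Proof.
move=> cA [w0 w1] Ax.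
have [i0 _|I0] := pickP (fun _ : I => true); last first.
  by move/eqP: w1; rewrite big_pred0// eq_sym oner_eq0.
(* Partial sums may have zero total weight, so normalisation is avoided: a partial
   sum is its total weight times some point of [A]. *)
suff [a Aa] : exists2 a, A a & \sum_i w i *: x i = (\sum_i w i) *: a.
  by rewrite w1 scale1r => ->.
rewrite !unlock; elim: (index_enum I) => [|i s [a Aa /= IH]].
  by exists (x i0); rewrite //= scale0r.
rewrite /= IH; set W := reducebig 0 s _.
have W0 : 0 <= W by rewrite /W; elim: s {IH W} => //= j s IH; rewrite addr_ge0.
have [s0|s_neq0] := eqVneq (w i + W) 0.
  move/eqP: (s0); rewrite paddr_eq0// => /andP[/eqP wi0 /eqP ->].
  by exists a => //; rewrite wi0 !scale0r !add0r scale0r.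
have s0 : 0 < w i + W by rewrite lt_neqAle eq_sym s_neq0 addr_ge0.
have t01 : 0 <= w i / (w i + W) <= 1.
  by rewrite (divr_ge0 _ (ltW s0))//= ler_pdivrMr// mul1r lerDl.
have := cA (x i) a (Itv01 (andP t01).1 (andP t01).2).
rewrite !inE => /(_ (Ax i) Aa) H.
eexists; first exact: H.
rewrite /conv/= scalerDr !scalerA; congr (_ *: _ + _ *: _); first by field.
by transitivity ((w i + W) * (1 - w i / (w i + W))); [field|].
Qed.

(** Jensen's inequality: the hypograph of a concave function is convex. *)
Lemma concave_barycenter (R : numFieldType) (E : lmodType R) (D : set E)
    (f : E -> R) (I : finType) (w : I -> R) (x : I -> E) :
  convex_set D -> concave_function D f -> barycentric w -> (forall i, D (x i)) ->
  \sum_i w i * f (x i) <= f (\sum_i w i *: x i).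
Proof.
move=> cD cf wS Dx.
pose H : set (E * R^o) := [set z | D z.1 /\ z.2 <= f z.1].
have cH : convex_set H.
  move=> a b t; rewrite !inE => -[Da fa] [Db fb]; split.
    by have := cD a.1 b.1 t; rewrite !inE; apply.
  apply: le_trans (cf t a.1 b.1 _ _); rewrite ?inE//.
  by rewrite lerD// ler_wpM2l// subr_ge0.
have [|_] := @convex_set_barycenter _ _ H I w (fun i => (x i, f (x i))) cH wS.
  by move=> i; split; rewrite /=.
suff -> : \sum_i w i *: ((x i, f (x i)) : E * R^o) =
  (\sum_i w i *: x i, \sum_i w i * f (x i)) by [].
by elim/big_rec3: _ => // i a b _ _ ->.
Qed.

(** Continuity of the vector operations, uniformly in the coefficients: barycenters
    of the same points with close weights are close. *)
Lemma near_perturbation (R : realFieldType) (E : topologicalLmodType R)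
    (I : finType) (x : I -> E) (p : E) (U : set E) : nbhs p U ->
  exists2 d : R, 0 < d & \forall q \near p, forall a : I -> R,
    (forall i, `|a i| <= d) -> U (q + \sum_i a i *: x i).
Proof.
move=> pU; rewrite unlock; elim: (index_enum I) => [|i s [d d0 IH]].
  by exists 1 => //; apply: filterS pU => q Uq a _; rewrite /= addr0.
have : {for ((0 : R^o), p), continuous (fun z : R^o * E => z.2 + z.1 *: x i)}.
  apply: (@continuous_comp _ _ _ (fun z : R^o * E => (z.2, z.1 *: x i))
    (fun z : E * E => z.1 + z.2)); last exact: add_continuous.
  apply: cvg_pair; first exact: cvg_snd.
  apply: (@continuous_comp _ _ _ (fun z : R^o * E => (z.1, x i))
    (fun z : R^o * E => z.1 *: z.2)); last exact: scale_continuous.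
  by apply: (@cvg_pair _ _ _ _ (nbhs (0 : R^o))); [exact: cvg_fst|exact: cvg_cst].
move=> cont; have p0 : p + (0 : R) *: x i = p by rewrite scale0r addr0.
move: IH; rewrite /prop_near1 -{1}p0 => /cont [[A B] /= [A0 Bp] AB].
have [e /= e0 eA] := (nbhs_ballP _ _).1 A0.
exists (Num.min d (e / 2)); first by rewrite lt_min d0 divr_gt0.
apply: filterS Bp => q Bq a ad.
rewrite addrA; apply: (AB (a i, q)).
  split=> //; apply: eA; rewrite -ball_normE /= sub0r normrN.
  by rewrite (le_lt_trans (ad i))// gt_min ltr_pdivrMr// ltr_pMr// ltr1n orbT.
by move=> j; rewrite (le_trans (ad j))// ge_min lexx.
Qed.

(** * Ky Fan's inequality and equilibria *)

(** The points [q] whose weights [w] are close to weights labelled by each index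
    of the support of [w], where labels maximise [g], cluster at some [p]. If
    [g k p] is the maximum of the [g i p] and is positive, then near [p] each
    index [i] of the support has [g i q > 0], as [g i] is about as large as [g k]
    there; this contradicts [\sum_i w i * g i q <= 0]. *)
Lemma exists_all_le0_finite (R : realType) (E : topologicalLmodType R)
    (K : set E) (I : finType) (i0 : I) (x : I -> E) (g : I -> E -> R) :
  compact K -> convex_set K -> (forall i, K (x i)) ->
  (forall i, {within K, continuous (g i)}) ->
  (forall w, barycentric w ->
    \sum_i w i * g i (\sum_j w j *: x j) <= 0) ->
  exists2 p, K p & forall i, g i p <= 0.
Proof.
move=> cptK cK Kx cg g_le0.
pose pt (w : I -> R) := \sum_i w i *: x i.
have Kpt w : barycentric w -> K (pt w) by move=> wS; exact: convex_set_barycenter.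
pose lab w := [arg max_(i > i0) g i (pt w)]%O.
have labP w k : g k (pt w) <= g (lab w) (pt w).
  by rewrite /lab; case: arg_maxP => // i _; exact.
pose good (d : R) := [set q | exists w, [/\ barycentric w, q = pt w &
  forall i, 0 < w i -> exists w',
    [/\ barycentric w', lab w' = i & forall j, `|w' j - w j| <= d]]].
have FF : ProperFilter (filter_from [set d : R | 0 < d] good).
  apply: filter_from_proper; last first.
    by move=> d d0; have [w wS wl] := simplex_labels lab d0; exists (pt w), w.
  apply: filter_from_filter; first by exists 1 => /=.
  move=> d e d0 e0; exists (Num.min d e); first by rewrite /= lt_min d0.
  move=> q [w [wS qw wl]]; split; exists w; split=> // i /wl[w' [? ? H]];
    by exists w'; split=> // j; rewrite (le_trans (H j))// ge_min lexx ?orbT.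
have [|p [Kp clp]] := cptK _ FF.
  by exists 1 => //= q [w [wS -> _]]; exact: Kpt.
exists p => // k0; rewrite leNgt; apply/negP => gk0.
have [k gk] : exists k, forall i, g i p <= g k p.
  exists [arg max_(i > i0) g i p]%O.
  by case: arg_maxP => // i _ H j; exact: H.
have {k0 gk0} gkp : 0 < g k p by exact: lt_le_trans (gk k0).
pose eps := g k p / 3%:R.
have eps0 : 0 < eps by rewrite divr_gt0.
pose U := [set z | forall i, K z -> `|g i p - g i z| < eps].
have pU : nbhs p U.
  apply: filter_forall => i.
  have /subspace_continuousP /(_ _ Kp) := cg i.
  by move=> /cvgrPdist_lt /(_ _ eps0).
have [d d0 pV] := near_perturbation x pU.
have [q [[w [wS qw wl]] [Uq Vq]]] := clp (good d) _ (ex_intro2 _ _ d d0 (@subset_refl _ _))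
  (filterI pU pV).
have Kq : K q by rewrite qw; exact: Kpt.
have gpos i : 0 < w i -> 0 < g i q.
  move=> /wl[w' [w'S lw' ww']].
  have Uz : U (pt w').
    rewrite (_ : pt w' = q + \sum_i (w' i - w i) *: x i); first exact: Vq.
    rewrite qw /pt -big_split/=; apply: eq_bigr => j _.
    by rewrite -scalerDl addrC subrK.
  have := labP w' k; rewrite lw'.
  have := Uz i (Kpt _ w'S); have := Uz k (Kpt _ w'S); have := Uq i Kq.
  rewrite !ltr_norml => /andP[_ a] /andP[_ b] /andP[c _] h.
  move: a b c h; rewrite /eps; lra.
have [w0 w1] := wS.
have wg0 i : true -> 0 <= w i * g i q.
  have := w0 i; rewrite le_eqVlt => /predU1P[<-|wi]; first by rewrite mul0r.
  by move=> _; rewrite mulr_ge0// ltW// gpos.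
have : \sum_i w i * g i q == 0.
  by rewrite eq_le sumr_ge0// andbT qw; exact: g_le0.
rewrite psumr_eq0// => /allP H; move/eqP: w1; rewrite big1 1?eq_sym ?oner_eq0// => i _.
apply/eqP; rewrite eq_le w0 andbT leNgt; apply/negP => wi.
have := H i; rewrite mem_index_enum => /(_ isT) /=.
by rewrite mulf_eq0 !gt_eqF// gpos.
Qed.

(** The solution sets for finitely many [x] are nonempty by the finite case, and
    generate a filter on the compact set [K]; a cluster point of this filter is a
    solution for every [x], by continuity. *)
Theorem ky_fan_inequality (R : realType) (E : topologicalLmodType R) (K : set E)
    (f : E -> E -> R) :
  K !=set0 -> compact K -> convex_set K ->
  (forall x, K x -> {within K, continuous (f x)}) ->
  (forall y, K y -> concave_function K (f^~ y)) ->
  (forall y, K y -> f y y <= 0) ->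
  exists2 y, K y & forall x, K x -> f x y <= 0.
Proof.
move=> [x0 Kx0] cptK cK cf ccf f_le0.
pose D := [set s : seq E | forall x, x \in s -> K x].
pose sol (s : seq E) := [set y | K y /\ forall x, x \in s -> f x y <= 0].
have FF : ProperFilter (filter_from D sol).
  apply: filter_from_proper.
    apply: filter_from_filter; first by exists [::].
    move=> s t Ds Dt; exists (s ++ t).
      by move=> x; rewrite mem_cat => /orP[/Ds|/Dt].
    by move=> y [Ky H]; split; split=> // x xs; apply: H; rewrite mem_cat xs ?orbT.
  move=> s Ds.
  (* [x0] is added because the finite case requires at least one point. *)
  have Dx (i : 'I_(size (x0 :: s))) : K (tnth (in_tuple (x0 :: s)) i).
    by have := mem_tnth i (in_tuple (x0 :: s)); rewrite inE => /predU1P[->//|/Ds].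
  have [] := @exists_all_le0_finite _ _ K _ ord0 _ (fun i => f (tnth (in_tuple (x0 :: s)) i)) cptK cK Dx.
  - by move=> i; exact/cf/Dx.
  - move=> w wS; have Kw := convex_set_barycenter cK wS Dx.
    apply: le_trans (f_le0 _ Kw).
    exact: (concave_barycenter cK (ccf _ Kw) wS Dx).
  move=> y Ky H; exists y; split=> // x xs.
  have /seq_tnthP[i ->] : x \in x0 :: s by rewrite inE xs orbT.
  exact: H.
have [|y [Ky cly]] := cptK _ FF; first by exists [::] => // y [].
exists y => // x Kx; rewrite leNgt; apply/negP => fxy.
have Nf : nbhs y [set z | K z -> 0 < f x z].
  have /subspace_continuousP /(_ _ Ky) := cf x Kx.
  by move=> /cvgr_gt /(_ _ fxy).
have [|z [[Kz fz] /(_ Kz)]] := cly (sol [:: x]) _ _ Nf.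
  by exists [:: x] => // z; rewrite inE => /eqP ->.
by rewrite ltNge fz// inE.
Qed.

Theorem theorem4p2 (R : realType) (X1 X2 : tvsType R)
    (hausX1 : hausdorff_space X1) (hausX2 : hausdorff_space X2)
    (Omega1 : set X1) (Omega2 : set X2)
    (neOmega1 : Omega1 !=set0) (neOmega2 : Omega2 !=set0)
    (cptOmega1 : compact Omega1) (cptOmega2 : compact Omega2)
    (cvxOmega1 : convex_set Omega1) (cvxOmega2 : convex_set Omega2)
    (u1 u2 : X1 * X2 -> R)
    (cont_u1 : continuous u1) (cont_u2 : continuous u2)
    (concave_u1 : forall q, Omega2 q ->
       concave_function [set: X1] (fun p => u1 (p, q)))
    (concave_u2 : forall p, Omega1 p ->
       concave_function [set: X2] (fun q => u2 (p, q))) :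
  exists pq : X1 * X2, nash_equilibrium Omega1 Omega2 u1 u2 pq.
Proof.
pose f (x y : X1 * X2) := (u1 (x.1, y.2) - u1 y) + (u2 (y.1, x.2) - u2 y).
have [| | | | | |y [Ky1 Ky2] fy] := @ky_fan_inequality R (X1 * X2)%type (Omega1 `*` Omega2) f.
- by have [p Op] := neOmega1; have [q Oq] := neOmega2; exists (p, q).
- exact: compact_setX.
- move=> a b t; rewrite !inE => -[a1 a2] [b1 b2]; split.
    by have := cvxOmega1 a.1 b.1 t; rewrite !inE; apply.
  by have := cvxOmega2 a.2 b.2 t; rewrite !inE; apply.
- move=> x _; apply: continuous_subspaceT => y.
  apply: cvgD; apply: cvgB; try exact: cont_u1; try exact: cont_u2.
    apply: (@continuous_comp _ _ _ (fun y : X1 * X2 => (x.1, y.2)) u1); last exact: cont_u1.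
    by apply: cvg_pair => /=; [exact: cvg_cst|exact: cvg_snd].
  apply: (@continuous_comp _ _ _ (fun y : X1 * X2 => (y.1, x.2)) u2); last exact: cont_u2.
  by apply: cvg_pair => /=; [exact: cvg_fst|exact: cvg_cst].
- move=> y [Ky1 Ky2] t a b _ _.
  have := concave_u1 _ Ky2 t a.1 b.1; have := concave_u2 _ Ky1 t a.2 b.2.
  rewrite !inE => /(_ I I) h2 /(_ I I) h1.
  (* The hypotheses and the goal with their convex combinations made explicit. *)
  rewrite /f /=; set s := t%:num.
  have {}h1 : s * u1 (a.1, y.2) + (1 - s) * u1 (b.1, y.2) <= _ := h1.
  have {}h2 : s * u2 (y.1, a.2) + (1 - s) * u2 (y.1, b.2) <= _ := h2.
  change (s * (u1 (a.1, y.2) - u1 y + (u2 (y.1, a.2) - u2 y)) +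
    (1 - s) * (u1 (b.1, y.2) - u1 y + (u2 (y.1, b.2) - u2 y)) <=
    u1 (s *: a.1 + (1 - s) *: b.1, y.2) - u1 y +
    (u2 (y.1, s *: a.2 + (1 - s) *: b.2) - u2 y)).
  rewrite /conv /= in h1 h2; lra.
- by move=> y _; rewrite /f -!surjective_pairing !subrr addr0.
exists y; split=> // [p Op|q Oq].
  have := fy (p, y.2) (conj Op Ky2); rewrite /f /= -surjective_pairing subrr addr0.
  by rewrite subr_le0.
have := fy (y.1, q) (conj Ky1 Oq); rewrite /f /= -surjective_pairing subrr add0r.
by rewrite subr_le0.
Qed.
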